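(* Let $\mathcal{A}$ be an ideally regular category. Let $U\colon\mathcal{A}\to\mathcal{X}$ be a monadic functor such that - $\mathcal{X}$ is homological and has finite coproducts; - the monad $\mathbb{T}$ on $\mathcal{X}$ corresponding to $U$ is essentially nullary; - the functor $T\colon\mathcal{X}\to\mathcal{X}$ underlying $\mathbb{T}$ preserves regular epimorphisms and kernel pairs. Then for every object $A$ in $\mathcal{A}$, the following (possibly large) posets are canonically isomorphic to each other: (a) $\mathrm{Quot}_{\mathcal{A}}(A)$, consisting of quotient objects of $A$ in $\mathcal{A}$; (b) $\mathrm{EERel}_{\mathcal{A}}(A)$, consisting of effective equivalence relations on $A$ in $\mathcal{A}$; (c) $\mathrm{EERel}_{\mathcal{X}}(U(A))$, consisting of effective equivalence relations on $U(A)$ in $\mathcal{X}$; (d) $\mathrm{Quot}_{\mathcal{X}}(U(A))$, consisting of quotient objects of $U(A)$ in $\mathcal{X}$; (e) $\mathrm{NSub}_{\mathcal{X}}(U(A))$, consisting of normal subobjects of $U(A)$ in $\mathcal{X}$.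
   Context: $0$ and $1$ denote the initial and terminal objects. A category is regular if it is finitely complete, has coequalisers of kernel pairs, and regular epimorphisms are stable under pullback. For an object $X$ of a finitely complete category $\mathcal{C}$, $\mathrm{Pt}_X(\mathcal{C})$ denotes the category of points over $X$: its objects are triples $(A,\alpha\colon A\to X,\sigma\colon X\to A)$ with $\alpha\circ\sigma=1_X$, and its morphisms are the morphisms over $X$ commuting with the sections. $\mathcal{C}$ is Bourn protomodular if it is finitely complete and for every morphism $f\colon Y\to X$ the pullback functor $f^\ast\colon\mathrm{Pt}_X(\mathcal{C})\to\mathrm{Pt}_Y(\mathcal{C})$ reflects isomorphisms. A category is homological if it is pointed, regular and Bourn protomodular. In a category $\mathcal{C}$ with pullbacks, a morphism $p\colon E\to B$ is effective for descent if the pullback functor $p^\ast\colon\mathcal{C}/B\to\mathcal{C}/E$ between slice categories is monadic. A category is ideally regular if it is a regular, Bourn protomodular category with finite coproducts in which the unique morphism $0\to1$ is effective for descent. A functor $U\colon\mathcal{A}\to\mathcal{X}$ is monadic if it has a left adjoint $F$ and the comparison functor from $\mathcal{A}$ to the Eilenberg–Moore category of the monad induced by $F\dashv U$ is an equivalence; the corresponding monad is this induced monad on $\mathcal{X}$. A monad $\mathbb{T}=(T,\eta,\mu)$ on a category $\mathcal{X}$ with finite coproducts is essentially nullary if for every object $X$ of $\mathcal{X}$ the morphism $(T(!_X),\eta_X)\colon T(0)+X\to T(X)$, where $!_X\colon 0\to X$ is the unique morphism, is a strong epimorphism. A functor $T$ preserves kernel pairs if, whenever $(r_0,r_1)$ is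 the kernel pair of $f$, $(T(r_0),T(r_1))$ is the kernel pair of $T(f)$. Quotient objects are regular quotients, i.e. isomorphism classes of regular epimorphisms $q$ with the given domain, ordered by $q\le q'$ iff $q'$ factors through $q$. An effective equivalence relation on an object is (the isomorphism class of) a relation that is the kernel pair of some morphism, ordered by inclusion as relations. A normal subobject is a subobject represented by a kernel of some morphism, ordered by inclusion of subobjects. The canonical maps are: sending a quotient to its kernel pair (between (a) and (b), and between (d) and (c)); sending an effective equivalence relation $(R,r_0,r_1)$ on $A$ to $(U(R),U(r_0),U(r_1))$ (from (b) to (c)); and sending a quotient of $U(A)$ to its kernel (from (d) to (e)). *)

(* Defs.v *)
From Corelib Require Import ssreflect ssrfun ssrbool.
From Stdlib Require Import Relations FinFun.
From Stdlib Require Import ProofIrrelevance FunctionalExtensionality.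
From Stdlib Require Import PropExtensionality ClassicalEpsilon.

Set Implicit Arguments.
Unset Strict Implicit.
Unset Printing Implicit Defensive.

Record Category := {
  ob :> Type;
  hom : ob -> ob -> Type;
  idm : forall x, hom x x;
  comp : forall x y z, hom y z -> hom x y -> hom x z;
  comp_idl : forall x y (f : hom x y), comp (idm y) f = f;
  comp_idr : forall x y (f : hom x y), comp f (idm x) = f;
  comp_assoc : forall w x y z (h : hom y z) (g : hom x y) (f : hom w x),
    comp h (comp g f) = comp (comp h g) f }.

Arguments hom {c} _ _.
Arguments idm {c} _.
Arguments comp {c x y z} _ _.

Declare Scope cat_scope.
Delimit Scope cat_scope with cat.
Open Scope cat_scope.
Notation "x ~> y" := (hom x y) (at level 90, y at level 89, no associativity)
  : cat_scope.
Notation "g ∘ f" := (comp g f) (at level 40, left associativity) : cat_scope.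

Record Functor (C D : Category) := {
  fob :> C -> D;
  fmap : forall x y : C, (x ~> y) -> (fob x ~> fob y);
  fmap_id : forall x : C, fmap (idm x) = idm (fob x);
  fmap_comp : forall (x y z : C) (g : y ~> z) (f : x ~> y),
    fmap (g ∘ f) = fmap g ∘ fmap f }.

Arguments fmap {C D} _ {x y} _.

Definition id_functor (C : Category) : Functor C C.
Proof. by refine (@Build_Functor C C (fun x => x) (fun _ _ f => f) _ _). Defined.

Definition comp_functor (C D E : Category) (G : Functor D E) (F : Functor C D) :
  Functor C E.
Proof.
refine (@Build_Functor C E (fun x => G (F x)) (fun _ _ f => fmap G (fmap F f)) _ _).
- abstract (by move=> x; rewrite !fmap_id).
- abstract (by move=> x y z g f; rewrite !fmap_comp).
Defined.

Record NatTrans (C D : Category) (F G : Functor C D) := {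
  component :> forall x : C, F x ~> G x;
  naturality : forall (x y : C) (f : x ~> y),
    component y ∘ fmap F f = fmap G f ∘ component x }.

Definition is_iso (C : Category) (x y : C) (f : x ~> y) : Prop :=
  exists g : y ~> x, g ∘ f = idm x /\ f ∘ g = idm y.

Definition is_mono (C : Category) (x y : C) (f : x ~> y) : Prop :=
  forall (w : C) (g h : w ~> x), f ∘ g = f ∘ h -> g = h.

Definition is_epi (C : Category) (x y : C) (f : x ~> y) : Prop :=
  forall (z : C) (g h : y ~> z), g ∘ f = h ∘ f -> g = h.

Definition is_strong_epi (C : Category) (x y : C) (e : x ~> y) : Prop :=
  is_epi e /\
  forall (a b : C) (m : a ~> b) (u : x ~> a) (v : y ~> b),
    is_mono m -> m ∘ u = v ∘ e ->
    exists d : y ~> a, d ∘ e = u /\ m ∘ d = v.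

Definition is_coequaliser (C : Category) (r x q : C)
    (r0 r1 : r ~> x) (e : x ~> q) : Prop :=
  e ∘ r0 = e ∘ r1 /\
  forall (z : C) (g : x ~> z), g ∘ r0 = g ∘ r1 -> exists! h : q ~> z, h ∘ e = g.

Definition is_regular_epi (C : Category) (x q : C) (e : x ~> q) : Prop :=
  exists (r : C) (r0 r1 : r ~> x), is_coequaliser r0 r1 e.

Record Cone (J C : Category) (D : Functor J C) := {
  cone_apex : C;
  cone_leg : forall j : J, cone_apex ~> D j;
  cone_comm : forall (i j : J) (f : i ~> j), fmap D f ∘ cone_leg i = cone_leg j }.

Definition is_limit (J C : Category) (D : Functor J C) (K : Cone D) : Prop :=
  forall K' : Cone D, exists! h : cone_apex K' ~> cone_apex K,
    forall j : J, cone_leg K j ∘ h = cone_leg K' j.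

Definition finite_category (J : Category) : Prop :=
  Finite J /\ forall i j : J, Finite (i ~> j).

Definition finitely_complete (C : Category) : Prop :=
  forall (J : Category) (D : Functor J C), finite_category J ->
    exists K : Cone D, is_limit K.

Definition is_terminal (C : Category) (t : C) : Prop :=
  forall x : C, exists! f : x ~> t, True.

Definition is_initial (C : Category) (z : C) : Prop :=
  forall x : C, exists! f : z ~> x, True.

Definition is_pullback (C : Category) (x y z p : C) (f : x ~> z) (g : y ~> z)
    (p1 : p ~> x) (p2 : p ~> y) : Prop :=
  f ∘ p1 = g ∘ p2 /\
  forall (w : C) (a : w ~> x) (b : w ~> y), f ∘ a = g ∘ b ->
    exists! h : w ~> p, p1 ∘ h = a /\ p2 ∘ h = b.

Definition is_coproduct (C : Category) (I : Type) (F : I -> C) (s : C)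
    (inj : forall i, F i ~> s) : Prop :=
  forall (z : C) (g : forall i, F i ~> z),
    exists! h : s ~> z, forall i, h ∘ inj i = g i.

Definition is_binary_coproduct (C : Category) (x y s : C)
    (i1 : x ~> s) (i2 : y ~> s) : Prop :=
  forall (z : C) (f : x ~> z) (g : y ~> z),
    exists! h : s ~> z, h ∘ i1 = f /\ h ∘ i2 = g.

Definition has_finite_coproducts (C : Category) : Prop :=
  forall (I : Type) (F : I -> C), Finite I ->
    exists (s : C) (inj : forall i, F i ~> s), is_coproduct inj.

Definition is_kernel_pair (C : Category) (x y r : C) (f : x ~> y)
    (r0 r1 : r ~> x) : Prop :=
  is_pullback f f r0 r1.

Definition is_regular_category (C : Category) : Prop :=
  [/\ finitely_complete C,
      forall (x y r : C) (f : x ~> y) (r0 r1 : r ~> x), is_kernel_pair f r0 r1 ->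
        exists (q : C) (e : x ~> q), is_coequaliser r0 r1 e
    & forall (x y z p : C) (f : x ~> z) (g : y ~> z) (p1 : p ~> x) (p2 : p ~> y),
        is_pullback f g p1 p2 -> is_regular_epi g -> is_regular_epi p1].

Record Pullback (C : Category) (x y z : C) (f : x ~> z) (g : y ~> z) := {
  pb_ob : C;
  pb_fst : pb_ob ~> x;
  pb_snd : pb_ob ~> y;
  pb_spec : is_pullback f g pb_fst pb_snd }.

Definition Pullbacks (C : Category) : Type :=
  forall (x y z : C) (f : x ~> z) (g : y ~> z), Pullback f g.

Definition pb_pair (C : Category) (x y z : C) (f : x ~> z) (g : y ~> z)
    (P : Pullback f g) (w : C) (a : w ~> x) (b : w ~> y) (e : f ∘ a = g ∘ b) :
  w ~> pb_ob P :=
  sval (constructive_indefinite_description _ (proj2 (pb_spec P) w a b e)).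

Lemma pb_pair_fst (C : Category) (x y z : C) (f : x ~> z) (g : y ~> z)
    (P : Pullback f g) (w : C) (a : w ~> x) (b : w ~> y) (e : f ∘ a = g ∘ b) :
  pb_fst P ∘ pb_pair P e = a.
Proof. by rewrite /pb_pair; case: constructive_indefinite_description => h [[]]. Qed.

Lemma pb_pair_snd (C : Category) (x y z : C) (f : x ~> z) (g : y ~> z)
    (P : Pullback f g) (w : C) (a : w ~> x) (b : w ~> y) (e : f ∘ a = g ∘ b) :
  pb_snd P ∘ pb_pair P e = b.
Proof. by rewrite /pb_pair; case: constructive_indefinite_description => h [[]]. Qed.

Lemma pb_eq (C : Category) (x y z : C) (f : x ~> z) (g : y ~> z)
    (P : Pullback f g) (w : C) (h k : w ~> pb_ob P) :
  pb_fst P ∘ h = pb_fst P ∘ k -> pb_snd P ∘ h = pb_snd P ∘ k -> h = k.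
Proof.
move=> e1 e2; have [sq univ] := pb_spec P.
have [l [_ U]] : exists! l : w ~> pb_ob P,
    pb_fst P ∘ l = pb_fst P ∘ h /\ pb_snd P ∘ l = pb_snd P ∘ h.
  by apply: univ; rewrite !comp_assoc sq.
by rewrite -(U h) // (U k).
Qed.

Record SliceOb (C : Category) (b : C) := {
  sl_dom : C;
  sl_arr : sl_dom ~> b }.

Record SliceHom (C : Category) (b : C) (x y : SliceOb b) := {
  sl_map : sl_dom x ~> sl_dom y;
  sl_comm : sl_arr y ∘ sl_map = sl_arr x }.

Lemma slice_hom_eq (C : Category) (b : C) (x y : SliceOb b) (f g : SliceHom x y) :
  sl_map f = sl_map g -> f = g.
Proof.
case: f g => [f ef] [g eg] /= e; rewrite -{}e in eg *.
by rewrite (proof_irrelevance _ ef eg).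
Qed.

Definition Slice (C : Category) (b : C) : Category.
Proof.
unshelve refine (@Build_Category (SliceOb b) (@SliceHom C b)
  (fun x => @Build_SliceHom C b x x (idm _) (comp_idr _))
  (fun x y z g f => @Build_SliceHom C b x z (sl_map g ∘ sl_map f) _) _ _ _).
- abstract (by rewrite comp_assoc !sl_comm).
- abstract (by move=> x y f; apply: slice_hom_eq; rewrite /= comp_idl).
- abstract (by move=> x y f; apply: slice_hom_eq; rewrite /= comp_idr).
- abstract (by move=> w x y z h g f; apply: slice_hom_eq; rewrite /= comp_assoc).
Defined.

Definition slice_pullback_ob (C : Category) (pb : Pullbacks C) (e b : C) (p : e ~> b)
    (x : SliceOb b) : SliceOb e :=
  Build_SliceOb (pb_fst (pb _ _ _ p (sl_arr x))).

Definition slice_pullback_map (C : Category) (pb : Pullbacks C) (e b : C) (p : e ~> b)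
    (x y : SliceOb b) (f : SliceHom x y) :
  SliceHom (slice_pullback_ob pb p x) (slice_pullback_ob pb p y).
Proof.
unshelve refine (@Build_SliceHom C e (slice_pullback_ob pb p x) (slice_pullback_ob pb p y)
  (@pb_pair _ _ _ _ _ _ (pb _ _ _ p (sl_arr y)) _
     (pb_fst (pb _ _ _ p (sl_arr x))) (sl_map f ∘ pb_snd _) _) _).
- abstract (by rewrite comp_assoc sl_comm; exact: (proj1 (pb_spec _))).
- abstract (by rewrite /= pb_pair_fst).
Defined.

Definition slice_pullback (C : Category) (pb : Pullbacks C) (e b : C) (p : e ~> b) :
  Functor (Slice b) (Slice e).
Proof.
refine (@Build_Functor (Slice b) (Slice e) (slice_pullback_ob pb p)
  (@slice_pullback_map C pb e b p) _ _).
- move=> x; apply: slice_hom_eq => /=.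
  by apply: pb_eq; rewrite ?pb_pair_fst ?pb_pair_snd comp_idr ?comp_idl.
- move=> x y z g f; apply: slice_hom_eq => /=.
  apply: pb_eq; rewrite [RHS]comp_assoc; first by rewrite !pb_pair_fst.
  by rewrite !pb_pair_snd -[RHS]comp_assoc pb_pair_snd [RHS]comp_assoc.
Defined.

Record PtOb (C : Category) (x : C) := {
  pt_dom : C;
  pt_arr : pt_dom ~> x;
  pt_sec : x ~> pt_dom;
  pt_secK : pt_arr ∘ pt_sec = idm x }.

Record PtHom (C : Category) (x : C) (a b : PtOb x) := {
  pt_map : pt_dom a ~> pt_dom b;
  pt_map_arr : pt_arr b ∘ pt_map = pt_arr a;
  pt_map_sec : pt_map ∘ pt_sec a = pt_sec b }.

Lemma pt_hom_eq (C : Category) (x : C) (a b : PtOb x) (f g : PtHom a b) :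
  pt_map f = pt_map g -> f = g.
Proof.
case: f g => [f ef sf] [g eg sg] /= e; rewrite -{}e in eg sg *.
by rewrite (proof_irrelevance _ ef eg) (proof_irrelevance _ sf sg).
Qed.

Definition Pt (C : Category) (x : C) : Category.
Proof.
unshelve refine (@Build_Category (PtOb x) (@PtHom C x)
  (fun a => @Build_PtHom C x a a (idm _) (comp_idr _) (comp_idl _))
  (fun a b c g f => @Build_PtHom C x a c (pt_map g ∘ pt_map f) _ _) _ _ _).
- abstract (by rewrite comp_assoc !pt_map_arr).
- abstract (by rewrite -comp_assoc !pt_map_sec).
- abstract (by move=> a b f; apply: pt_hom_eq; rewrite /= comp_idl).
- abstract (by move=> a b f; apply: pt_hom_eq; rewrite /= comp_idr).
- abstract (by move=> a b c d h g f; apply: pt_hom_eq; rewrite /= comp_assoc).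
Defined.

Definition pt_pullback_ob (C : Category) (pb : Pullbacks C) (y x : C) (f : y ~> x)
    (a : PtOb x) : PtOb y.
Proof.
unshelve refine (@Build_PtOb C y (pb_ob (pb _ _ _ f (pt_arr a))) (pb_fst _)
  (@pb_pair _ _ _ _ _ _ (pb _ _ _ f (pt_arr a)) _ (idm y) (pt_sec a ∘ f) _) _).
- abstract (by rewrite comp_assoc pt_secK comp_idl comp_idr).
- abstract (by rewrite pb_pair_fst).
Defined.

Definition pt_pullback_map (C : Category) (pb : Pullbacks C) (y x : C) (f : y ~> x)
    (a b : PtOb x) (h : PtHom a b) :
  PtHom (pt_pullback_ob pb f a) (pt_pullback_ob pb f b).
Proof.
unshelve refine (@Build_PtHom C y (pt_pullback_ob pb f a) (pt_pullback_ob pb f b)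
  (@pb_pair _ _ _ _ _ _ (pb _ _ _ f (pt_arr b)) _
     (pb_fst (pb _ _ _ f (pt_arr a))) (pt_map h ∘ pb_snd _) _) _ _).
- abstract (by rewrite comp_assoc pt_map_arr; exact: (proj1 (pb_spec _))).
- abstract (by rewrite /= pb_pair_fst).
- apply: pb_eq; rewrite [LHS]comp_assoc ?pb_pair_fst ?pb_pair_snd //.
  by rewrite -comp_assoc pb_pair_snd comp_assoc pt_map_sec.
Defined.

Definition pt_pullback (C : Category) (pb : Pullbacks C) (y x : C) (f : y ~> x) :
  Functor (Pt x) (Pt y).
Proof.
refine (@Build_Functor (Pt x) (Pt y) (pt_pullback_ob pb f)
  (@pt_pullback_map C pb y x f) _ _).
- move=> a; apply: pt_hom_eq => /=.
  by apply: pb_eq; rewrite ?pb_pair_fst ?pb_pair_snd comp_idr ?comp_idl.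
- move=> a b c h k; apply: pt_hom_eq => /=.
  apply: pb_eq; rewrite [RHS]comp_assoc; first by rewrite !pb_pair_fst.
  by rewrite !pb_pair_snd -[RHS]comp_assoc pb_pair_snd [RHS]comp_assoc.
Defined.

Record LeftAdjoint (A X : Category) (U : Functor A X) := {
  la_functor : Functor X A;
  la_unit : NatTrans (id_functor X) (comp_functor U la_functor);
  la_counit : NatTrans (comp_functor la_functor U) (id_functor A);
  la_triangle_l : forall x : X,
    la_counit (la_functor x) ∘ fmap la_functor (la_unit x) = idm (la_functor x);
  la_triangle_r : forall a : A,
    fmap U (la_counit a) ∘ la_unit (U a) = idm (U a) }.

Record Monad (X : Category) := {
  mon_functor :> Functor X X;
  mon_unit : NatTrans (id_functor X) mon_functor;
  mon_mult : NatTrans (comp_functor mon_functor mon_functor) mon_functor;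
  mon_idl : forall x : X, mon_mult x ∘ mon_unit (mon_functor x) = idm (mon_functor x);
  mon_idr : forall x : X,
    mon_mult x ∘ fmap mon_functor (mon_unit x) = idm (mon_functor x);
  mon_assoc : forall x : X,
    mon_mult x ∘ fmap mon_functor (mon_mult x) = mon_mult x ∘ mon_mult (mon_functor x) }.

Definition induced_mult (A X : Category) (U : Functor A X) (L : LeftAdjoint U) :
  NatTrans (comp_functor (comp_functor U (la_functor L)) (comp_functor U (la_functor L)))
           (comp_functor U (la_functor L)).
Proof.
refine (@Build_NatTrans X X
  (comp_functor (comp_functor U (la_functor L)) (comp_functor U (la_functor L)))
  (comp_functor U (la_functor L))
  (fun x => fmap U (la_counit L (la_functor L x))) _).
move=> x y f /=; rewrite -!fmap_comp; congr (fmap U _).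
exact: (naturality (la_counit L)).
Defined.

Definition induced_monad (A X : Category) (U : Functor A X) (L : LeftAdjoint U) :
  Monad X.
Proof.
refine (@Build_Monad X (comp_functor U (la_functor L)) (la_unit L) (induced_mult L) _ _ _).
- abstract (by move=> x /=; rewrite la_triangle_r).
- abstract (by move=> x /=; rewrite -fmap_comp la_triangle_l fmap_id).
- move=> x /=; rewrite -!fmap_comp; congr (fmap U _).
  exact: (naturality (la_counit L)).
Defined.

Record Algebra (X : Category) (T : Monad X) := {
  alg_ob : X;
  alg_act : T alg_ob ~> alg_ob;
  alg_unit : alg_act ∘ mon_unit T alg_ob = idm alg_ob;
  alg_mult : alg_act ∘ fmap T alg_act = alg_act ∘ mon_mult T alg_ob }.

Record AlgHom (X : Category) (T : Monad X) (a b : Algebra T) := {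
  alg_map : alg_ob a ~> alg_ob b;
  alg_map_comm : alg_map ∘ alg_act a = alg_act b ∘ fmap T alg_map }.

Lemma alg_hom_eq (X : Category) (T : Monad X) (a b : Algebra T) (f g : AlgHom a b) :
  alg_map f = alg_map g -> f = g.
Proof.
case: f g => [f ef] [g eg] /= e; rewrite -{}e in eg *.
by rewrite (proof_irrelevance _ ef eg).
Qed.

Definition EilenbergMoore (X : Category) (T : Monad X) : Category.
Proof.
unshelve refine (@Build_Category (Algebra T) (@AlgHom X T)
  (fun a => @Build_AlgHom X T a a (idm _) _)
  (fun a b c g f => @Build_AlgHom X T a c (alg_map g ∘ alg_map f) _) _ _ _).
- abstract (by rewrite fmap_id comp_idl comp_idr).
- abstract (by rewrite fmap_comp -comp_assoc alg_map_comm !comp_assoc alg_map_comm).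
- abstract (by move=> a b f; apply: alg_hom_eq; rewrite /= comp_idl).
- abstract (by move=> a b f; apply: alg_hom_eq; rewrite /= comp_idr).
- abstract (by move=> a b c d h g f; apply: alg_hom_eq; rewrite /= comp_assoc).
Defined.

Definition comparison_ob (A X : Category) (U : Functor A X) (L : LeftAdjoint U)
    (a : A) : Algebra (induced_monad L).
Proof.
refine (@Build_Algebra X (induced_monad L) (U a) (fmap U (la_counit L a)) _ _).
- abstract (exact: la_triangle_r).
- move=> /=; rewrite -!fmap_comp; congr (fmap U _).
  exact: (naturality (la_counit L)).
Defined.

Definition comparison_map (A X : Category) (U : Functor A X) (L : LeftAdjoint U)
    (a b : A) (f : a ~> b) : AlgHom (comparison_ob L a) (comparison_ob L b).
Proof.
refine (@Build_AlgHom X (induced_monad L) (comparison_ob L a) (comparison_ob L b)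
  (fmap U f) _).
move=> /=; rewrite -!fmap_comp; congr (fmap U _).
by symmetry; exact: (naturality (la_counit L)).
Defined.

Definition comparison (A X : Category) (U : Functor A X) (L : LeftAdjoint U) :
  Functor A (EilenbergMoore (induced_monad L)).
Proof.
refine (@Build_Functor A (EilenbergMoore (induced_monad L)) (comparison_ob L)
  (@comparison_map A X U L) _ _).
- abstract (by move=> a; apply: alg_hom_eq; rewrite /= fmap_id).
- abstract (by move=> a b c g f; apply: alg_hom_eq; rewrite /= fmap_comp).
Defined.

Definition is_equivalence (C D : Category) (F : Functor C D) : Prop :=
  exists G : Functor D C,
    (exists eta : NatTrans (id_functor C) (comp_functor G F),
       forall c : C, is_iso (eta c)) /\
    (exists eps : NatTrans (comp_functor F G) (id_functor D),
       forall d : D, is_iso (eps d)).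

Definition monadic_via (A X : Category) (U : Functor A X) (L : LeftAdjoint U) : Prop :=
  is_equivalence (comparison L).

Definition monadic (A X : Category) (U : Functor A X) : Prop :=
  exists L : LeftAdjoint U, monadic_via L.

Definition reflects_isos (C D : Category) (F : Functor C D) : Prop :=
  forall (x y : C) (f : x ~> y), is_iso (fmap F f) -> is_iso f.

(* Pullback functors for different choices of pullbacks are naturally
   isomorphic, so in the next two definitions [exists pb] amounts to
   [forall pb] when pullbacks exist. *)

Definition is_protomodular (C : Category) : Prop :=
  finitely_complete C /\
  exists pb : Pullbacks C,
    forall (y x : C) (f : y ~> x), reflects_isos (pt_pullback pb f).

Definition effective_for_descent (C : Category) (e b : C) (p : e ~> b) : Prop :=
  exists pb : Pullbacks C, monadic (slice_pullback pb p).

Definition is_zero_object (C : Category) (z : C) : Prop :=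
  is_initial z /\ is_terminal z.

Definition is_pointed (C : Category) : Prop := exists z : C, is_zero_object z.

Definition is_homological (C : Category) : Prop :=
  [/\ is_pointed C, is_regular_category C & is_protomodular C].

Definition is_ideally_regular (C : Category) : Prop :=
  [/\ is_regular_category C, is_protomodular C, has_finite_coproducts C
    & forall (z t : C) (p : z ~> t), is_initial z -> is_terminal t ->
        effective_for_descent p].

Definition essentially_nullary (X : Category) (T : Monad X) : Prop :=
  forall (z x s : X) (i1 : T z ~> s) (i2 : x ~> s) (u : z ~> x) (m : s ~> T x),
    is_initial z -> is_binary_coproduct i1 i2 ->
    m ∘ i1 = fmap T u -> m ∘ i2 = mon_unit T x -> is_strong_epi m.

Definition preserves_regular_epis (C D : Category) (F : Functor C D) : Prop :=
  forall (x y : C) (f : x ~> y), is_regular_epi f -> is_regular_epi (fmap F f).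

Definition preserves_kernel_pairs (C D : Category) (F : Functor C D) : Prop :=
  forall (x y r : C) (f : x ~> y) (r0 r1 : r ~> x),
    is_kernel_pair f r0 r1 -> is_kernel_pair (fmap F f) (fmap F r0) (fmap F r1).

Record Poset := {
  pcar :> Type;
  ple : pcar -> pcar -> Prop;
  ple_order : order pcar ple }.

Definition is_poset_iso (P Q : Poset) (f : P -> Q) : Prop :=
  bijective f /\ forall x y : P, ple x y <-> ple (f x) (f y).

(* The elements of the poset presented by [S] are the [rp_iso]-classes, as
   predicates, of the objects satisfying [rp_ok]. *)
Record Representatives := {
  rp_car : Type;
  rp_ok : rp_car -> Prop;
  rp_iso : rp_car -> rp_car -> Prop;
  rp_le : rp_car -> rp_car -> Prop;
  rp_isoP : equivalence rp_car rp_iso;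
  rp_leP : preorder rp_car rp_le;
  rp_iso_le : forall x y, rp_iso x y -> rp_le x y;
  rp_le_iso : forall x y, rp_ok x -> rp_ok y -> rp_le x y -> rp_le y x -> rp_iso x y }.

Definition is_class (S : Representatives) (c : rp_car S -> Prop) : Prop :=
  exists x, rp_ok x /\ forall y, c y <-> rp_ok y /\ rp_iso x y.

Definition class_of (S : Representatives) : Type := {c : rp_car S -> Prop | is_class c}.

Definition class_le (S : Representatives) (c d : class_of S) : Prop :=
  exists x y, [/\ sval c x, sval d y & rp_le x y].

Lemma class_le_order (S : Representatives) : order (class_of S) (@class_le S).
Proof.
have [_ itrans isym] := rp_isoP S; have [lrefl ltrans] := rp_leP S.
have iso_le (x y : rp_car S) : rp_iso y x -> rp_le x y.
  by move=> h; apply: rp_iso_le; exact: isym.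
split.
- move=> [c [x [ox hc]]]; have cx : c x by apply/hc; split=> //; case: (rp_isoP S).
  by exists x, x; split.
- move=> [c hc] [d [y0 [oy0 hd]]] [e he].
  move=> [x [y [/= cx /hd[_ y0y] xy]]] [y' [z [/= /hd[_ y0y'] ez yz]]].
  exists x, z; split=> //=; apply: (ltrans _ _ _ xy).
  apply: (ltrans _ y0); first exact: iso_le.
  by apply: (ltrans _ y'); first exact: rp_iso_le.
- move=> [c [x0 [ox0 hc]]] [d [y0 [oy0 hd]]].
  move=> [x [y [/= /hc[_ cx] /hd[_ dy] xy]]] [y' [x' [/= /hd[_ dy'] /hc[_ cx'] yx]]].
  have xy0 : rp_iso x0 y0.
    apply: rp_le_iso => //.
      apply: (ltrans _ x); first exact: rp_iso_le.
      by apply: (ltrans _ y) => //; exact: iso_le.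
    apply: (ltrans _ y'); first exact: rp_iso_le.
    by apply: (ltrans _ x') => //; exact: iso_le.
  suff e : c = d.
    by subst d; congr (exist _ c _); apply: proof_irrelevance.
  apply: functional_extensionality => w; apply: propositional_extensionality.
  rewrite hc hd; split=> -[ow h]; split=> //.
  + by apply: (itrans _ x0) => //; exact: isym.
  + exact: (itrans _ y0).
Qed.

Definition class_poset (S : Representatives) : Poset :=
  Build_Poset (class_le_order S).

Definition mem_class (S : Representatives) (c : class_poset S) (x : rp_car S) : Prop :=
  sval c x.

Record QuotRep (C : Category) (a : C) := {
  qt_cod : C;
  qt_map : a ~> qt_cod }.

Definition quot_le (C : Category) (a : C) (q q' : QuotRep a) : Prop :=
  exists h : qt_cod q ~> qt_cod q', h ∘ qt_map q = qt_map q'.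

Definition quot_iso (C : Category) (a : C) (q q' : QuotRep a) : Prop :=
  exists h : qt_cod q ~> qt_cod q', is_iso h /\ h ∘ qt_map q = qt_map q'.

Lemma is_iso_id (C : Category) (x : C) : is_iso (idm x).
Proof. by exists (idm x); rewrite comp_idl. Qed.

Lemma is_iso_comp (C : Category) (x y z : C) (g : y ~> z) (f : x ~> y) :
  is_iso g -> is_iso f -> is_iso (g ∘ f).
Proof.
move=> [g' [g'g gg']] [f' [f'f ff']]; exists (f' ∘ g'); split.
- by rewrite -comp_assoc [g' ∘ _]comp_assoc g'g comp_idl.
- by rewrite -comp_assoc [f ∘ _]comp_assoc ff' comp_idl.
Qed.

Lemma regular_epi_epi (C : Category) (x y : C) (f : x ~> y) :
  is_regular_epi f -> is_epi f.
Proof.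
move=> [r [r0 [r1 [e U]]]] z g h gh.
have [k [_ uk]] : exists! k, k ∘ f = g ∘ f by apply: U; rewrite -!comp_assoc e.
by rewrite -(uk g) // (uk h).
Qed.

Definition quot_reps (C : Category) (a : C) : Representatives.
Proof.
refine (@Build_Representatives (QuotRep a) (fun q => is_regular_epi (qt_map q))
  (@quot_iso C a) (@quot_le C a) _ _ _ _).
- split.
  + by move=> q; exists (idm _); split; [exact: is_iso_id | rewrite comp_idl].
  + move=> q q' q'' [h [ih eh]] [k [ik ek]]; exists (k ∘ h).
    by split; [exact: is_iso_comp | rewrite -comp_assoc eh].
  + move=> q q' [h [[k [kh hk]] eh]]; exists k; split; first by exists h.
    by rewrite -eh comp_assoc kh comp_idl.
- split.
  + by move=> q; exists (idm _); rewrite comp_idl.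
  + by move=> q q' q'' [h eh] [k ek]; exists (k ∘ h); rewrite -comp_assoc eh.
- by move=> q q' [h [_ eh]]; exists h.
- move=> q q' rq rq' [h eh] [k ek]; exists h; split=> //; exists k; split.
  + by apply: (regular_epi_epi rq); rewrite -comp_assoc eh ek comp_idl.
  + by apply: (regular_epi_epi rq'); rewrite -comp_assoc ek eh comp_idl.
Defined.

Definition Quot (C : Category) (a : C) : Poset := class_poset (quot_reps a).

Record RelRep (C : Category) (a : C) := {
  rel_ob : C;
  rel_fst : rel_ob ~> a;
  rel_snd : rel_ob ~> a }.

Definition is_kernel_pair_of (C : Category) (a b : C) (f : a ~> b) (r : RelRep a) :=
  is_kernel_pair f (rel_fst r) (rel_snd r).

Definition is_effective_equivalence (C : Category) (a : C) (r : RelRep a) : Prop :=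
  exists (b : C) (f : a ~> b), is_kernel_pair_of f r.

Definition rel_le (C : Category) (a : C) (r s : RelRep a) : Prop :=
  exists h : rel_ob r ~> rel_ob s,
    rel_fst s ∘ h = rel_fst r /\ rel_snd s ∘ h = rel_snd r.

Definition rel_iso (C : Category) (a : C) (r s : RelRep a) : Prop :=
  exists h : rel_ob r ~> rel_ob s,
    [/\ is_iso h, rel_fst s ∘ h = rel_fst r & rel_snd s ∘ h = rel_snd r].

Lemma effective_jointly_monic (C : Category) (a : C) (r : RelRep a) :
  is_effective_equivalence r ->
  forall (w : C) (h k : w ~> rel_ob r),
    rel_fst r ∘ h = rel_fst r ∘ k -> rel_snd r ∘ h = rel_snd r ∘ k -> h = k.
Proof.
move=> [b [f kp]] w h k.
exact: (@pb_eq _ _ _ _ _ _ (Build_Pullback kp)).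
Qed.

Definition eerel_reps (C : Category) (a : C) : Representatives.
Proof.
refine (@Build_Representatives (RelRep a) (@is_effective_equivalence C a)
  (@rel_iso C a) (@rel_le C a) _ _ _ _).
- split.
  + by move=> r; exists (idm _); split; rewrite ?comp_idr //; exact: is_iso_id.
  + move=> r s t [h [ih h0 h1]] [k [ik k0 k1]]; exists (k ∘ h).
    by split; [exact: is_iso_comp | rewrite comp_assoc k0 | rewrite comp_assoc k1].
  + move=> r s [h [[k [kh hk]] h0 h1]]; exists k; split; first by exists h.
      by rewrite -h0 -comp_assoc hk comp_idr.
    by rewrite -h1 -comp_assoc hk comp_idr.
- split.
  + by move=> r; exists (idm _); rewrite !comp_idr.
  + move=> r s t [h [h0 h1]] [k [k0 k1]]; exists (k ∘ h).
    by rewrite !comp_assoc k0 k1.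
- by move=> r s [h [_ h0 h1]]; exists h.
- move=> r s er es [h [h0 h1]] [k [k0 k1]]; exists h; split=> //; exists k; split.
  + by apply: (effective_jointly_monic er); rewrite comp_assoc ?k0 ?k1 ?h0 ?h1 comp_idr.
  + by apply: (effective_jointly_monic es); rewrite comp_assoc ?h0 ?h1 ?k0 ?k1 comp_idr.
Defined.

Definition EERel (C : Category) (a : C) : Poset := class_poset (eerel_reps a).

Definition rel_image (C D : Category) (F : Functor C D) (a : C) (r : RelRep a) :
  RelRep (F a) :=
  Build_RelRep (fmap F (rel_fst r)) (fmap F (rel_snd r)).

Definition is_zero_morphism (C : Category) (x y : C) (f : x ~> y) : Prop :=
  exists (z : C) (g : z ~> y) (h : x ~> z), is_zero_object z /\ f = g ∘ h.

Definition is_kernel_of (C : Category) (a b : C) (f : a ~> b) (k : SliceOb a) : Prop :=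
  is_zero_morphism (f ∘ sl_arr k) /\
  forall (w : C) (g : w ~> a), is_zero_morphism (f ∘ g) ->
    exists! h : w ~> sl_dom k, sl_arr k ∘ h = g.

Definition is_normal_mono (C : Category) (a : C) (k : SliceOb a) : Prop :=
  exists (b : C) (f : a ~> b), is_kernel_of f k.

Definition sub_le (C : Category) (a : C) (k l : SliceOb a) : Prop :=
  exists h : sl_dom k ~> sl_dom l, sl_arr l ∘ h = sl_arr k.

Definition sub_iso (C : Category) (a : C) (k l : SliceOb a) : Prop :=
  exists h : sl_dom k ~> sl_dom l, is_iso h /\ sl_arr l ∘ h = sl_arr k.

Lemma normal_mono_mono (C : Category) (a : C) (k : SliceOb a) :
  is_normal_mono k -> is_mono (sl_arr k).
Proof.
move=> [b [f [[z [u [v [zz e]]]] U]]] w g h gh.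
have [l [_ ul]] : exists! l, sl_arr k ∘ l = sl_arr k ∘ g.
  by apply: U; exists z, u, (v ∘ g); rewrite !comp_assoc e.
by rewrite -(ul g) // (ul h).
Qed.

Definition nsub_reps (C : Category) (a : C) : Representatives.
Proof.
refine (@Build_Representatives (SliceOb a) (@is_normal_mono C a)
  (@sub_iso C a) (@sub_le C a) _ _ _ _).
- split.
  + by move=> k; exists (idm _); split; [exact: is_iso_id | rewrite comp_idr].
  + move=> k l m [h [ih eh]] [g [ig eg]]; exists (g ∘ h).
    by split; [exact: is_iso_comp | rewrite comp_assoc eg].
  + move=> k l [h [[g [gh hg]] eh]]; exists g; split; first by exists h.
    by rewrite -eh -comp_assoc hg comp_idr.
- split.
  + by move=> k; exists (idm _); rewrite comp_idr.
  + by move=> k l m [h eh] [g eg]; exists (g ∘ h); rewrite comp_assoc eg.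
- by move=> k l [h [_ eh]]; exists h.
- move=> k l nk nl [h eh] [g eg]; exists h; split=> //; exists g; split.
  + by apply: (normal_mono_mono nk); rewrite comp_assoc eg eh comp_idr.
  + by apply: (normal_mono_mono nl); rewrite comp_assoc eh eg comp_idr.
Defined.

Definition NSub (C : Category) (a : C) : Poset := class_poset (nsub_reps a).

Definition sends_quotient_to_kernel_pair (C : Category) (a : C)
    (f : Quot a -> EERel a) : Prop :=
  forall (c : Quot a) (q : QuotRep a) (r : RelRep a),
    mem_class c q -> is_kernel_pair_of (qt_map q) r -> mem_class (f c) r.

Definition sends_relation_to_image (C D : Category) (F : Functor C D) (a : C)
    (f : EERel a -> EERel (F a)) : Prop :=
  forall (c : EERel a) (r : RelRep a),
    mem_class c r -> mem_class (f c) (rel_image F r).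

Definition sends_quotient_to_kernel (C : Category) (a : C)
    (f : Quot a -> NSub a) : Prop :=
  forall (c : Quot a) (q : QuotRep a) (k : SliceOb a),
    mem_class c q -> is_kernel_of (qt_map q) k -> mem_class (f c) k.

(* Main.v *)
From Corelib Require Import ssreflect ssrfun ssrbool.
From Stdlib Require Import Relations ClassicalEpsilon.
Require Import Defs.

(** In a regular category regular epimorphisms and kernel pairs determine each
    other, and in a homological one protomodularity lets kernels detect inclusions
    of kernel pairs.  The remaining point is that every effective equivalence
    relation [R], with quotient [q], on an algebra [(A, α)] is a congruence.  The
    maps [q α T(r0)] and [q α T(r1)] agree on [η_R], because [q] coequalises
    [r0, r1], and on [T(0)], because [0] is initial; as [T(0) + R -> T(R)] is epic
    they are equal.  Since [T(q)] is the coequaliser of [T(r0), T(r1)], the action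
    [α] descends along [q]. *)

Set Implicit Arguments.
Unset Strict Implicit.
Unset Printing Implicit Defensive.

(** * Posets of isomorphism classes *)

Section ClassPosets.

Variables S S' : Representatives.

Lemma mem_class_ok (c : class_poset S) (x : rp_car S) : mem_class c x -> rp_ok x.
Proof. by case: c => c [x0 [ok0 hc]] /hc[]. Qed.

Lemma mem_class_inhabited (c : class_poset S) : exists x, mem_class c x.
Proof.
case: c => c [x [okx hc]]; exists x; apply/hc; split=> //.
by case: (rp_isoP S).
Qed.

Lemma mem_class_iso (c : class_poset S) (x y : rp_car S) :
  mem_class c x -> (mem_class c y <-> rp_ok y /\ rp_iso x y).
Proof.
have [_ itrans isym] := rp_isoP S.
case: c => c [x0 [ok0 hc]] /hc[okx x0x]; rewrite /mem_class /= hc.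
split=> -[oky h]; split=> //; last exact: (itrans _ x).
by apply: (itrans _ x0) => //; exact: isym.
Qed.

Lemma class_exists (x : rp_car S) : rp_ok x -> exists c : class_poset S, mem_class c x.
Proof.
move=> okx.
have cl : is_class (fun y => rp_ok y /\ rp_iso x y) by exists x.
by exists (exist _ _ cl); split=> //; case: (rp_isoP S).
Qed.

Lemma ple_mem_class (c d : class_poset S) (x y : rp_car S) :
  mem_class c x -> mem_class d y -> (ple c d <-> rp_le x y).
Proof.
have [_ ltrans] := rp_leP S; have [_ _ isym] := rp_isoP S.
move=> cx dy; split; last by move=> xy; exists x, y.
move=> [x' [y' [cx' dy' xy]]].
have [_ ix] := proj1 (mem_class_iso x' cx) cx'.
have [_ iy] := proj1 (mem_class_iso y dy') dy.
apply: (ltrans _ x'); first exact: rp_iso_le.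
by apply: (ltrans _ y') => //; exact: rp_iso_le.
Qed.

End ClassPosets.

Lemma ple_refl (P : Poset) (x : P) : ple x x.
Proof. by case: (ple_order P). Qed.

Lemma ple_anti (P : Poset) (x y : P) : ple x y -> ple y x -> x = y.
Proof. by case: (ple_order P) => _ _; apply. Qed.

(** A relation [Phi] is used because kernel pairs and kernels are determined only up to isomorphism.
    Preserving and reflecting the preorder makes [Phi] compatible with isomorphism classes and, by
    antisymmetry, the induced map injective. *)
Lemma class_poset_iso (S S' : Representatives) (Phi : rp_car S -> rp_car S' -> Prop) :
  (forall x, rp_ok x -> exists y, Phi x y) ->
  (forall x y, rp_ok x -> Phi x y -> rp_ok y) ->
  (forall x x' y y', rp_ok x -> rp_ok x' -> Phi x y -> Phi x' y' ->
     (rp_le x x' <-> rp_le y y')) ->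
  (forall y, rp_ok y -> exists x y', [/\ rp_ok x, Phi x y' & rp_iso y' y]) ->
  exists f : class_poset S -> class_poset S', is_poset_iso f /\
    forall c x y, mem_class c x -> Phi x y -> mem_class (f c) y.
Proof.
move=> tot okPhi lePhi surj.
have fP (c : class_poset S) : exists d : class_poset S',
    exists x y, [/\ mem_class c x, Phi x y & mem_class d y].
  have [x cx] := mem_class_inhabited c.
  have [y xy] := tot x (mem_class_ok cx).
  have [d dy] := class_exists (okPhi x y (mem_class_ok cx) xy).
  by exists d, x, y.
(* [f] picks some class reached through [Phi] from some representative of [c]; [fmem] then shows
   that every representative leads to the same class. *)
pose f c := sval (constructive_indefinite_description _ (fP c)).
have fE c : exists x y, [/\ mem_class c x, Phi x y & mem_class (f c) y].
  by rewrite /f; case: constructive_indefinite_description.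
have mono c d : ple c d <-> ple (f c) (f d).
  have [x [y [cx xy fy]]] := fE c; have [x' [y' [dx' xy' fy']]] := fE d.
  rewrite (ple_mem_class cx dx') (ple_mem_class fy fy').
  by apply: lePhi => //; apply: mem_class_ok; eassumption.
have fmem c x y : mem_class c x -> Phi x y -> mem_class (f c) y.
  move=> cx xy; have [x' [y' [cx' xy' fy']]] := fE c.
  have okx := mem_class_ok cx; have okx' := mem_class_ok cx'.
  have [_ ix] := proj1 (mem_class_iso x cx') cx.
  have [_ ix'] := proj1 (mem_class_iso x' cx) cx'.
  have oky := okPhi _ _ okx xy.
  have oky' := okPhi _ _ okx' xy'.
  have le1 : rp_le y' y by apply/(lePhi x' x) => //; exact: rp_iso_le.
  have le2 : rp_le y y' by apply/(lePhi x x') => //; exact: rp_iso_le.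
  by apply/(mem_class_iso _ fy'); split=> //; exact: rp_le_iso.
exists f; split=> //; split=> //.
have inj c d : f c = f d -> c = d.
  by move=> e; apply: ple_anti; apply/mono; rewrite e; exact: ple_refl.
have sur d : exists c, f c = d.
  have [y dy] := mem_class_inhabited d; have oky := mem_class_ok dy.
  have [x [y' [okx xy' iy]]] := surj y oky.
  have [c cx] := class_exists okx; exists c.
  have fy' := fmem c x y' cx xy'.
  have fy : mem_class (f c) y by apply/(mem_class_iso _ fy').
  by apply: ple_anti; apply/ple_mem_class; try eassumption;
     case: (rp_leP S') => r _; exact: r.
pose g d := sval (constructive_indefinite_description _ (sur d)).
have gK d : f (g d) = d by rewrite /g; case: constructive_indefinite_description.
by exists g => // c; apply: inj; rewrite gK.
Qed.

(** * Regular epimorphisms and kernel pairs *)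

Section Categories.

Variable C : Category.

Lemma terminal_eq (t : C) : is_terminal t -> forall x (f g : x ~> t), f = g.
Proof. by move=> tt x f g; have [h [_ u]] := tt x; rewrite -(u f) // (u g). Qed.

Lemma initial_eq (z : C) : is_initial z -> forall x (f g : z ~> x), f = g.
Proof. by move=> iz x f g; have [h [_ u]] := iz x; rewrite -(u f) // (u g). Qed.

Lemma strong_epi_epi (x y : C) (e : x ~> y) : is_strong_epi e -> is_epi e.
Proof. by case. Qed.

Lemma coequaliser_regular_epi (r x q : C) (r0 r1 : r ~> x) (e : x ~> q) :
  is_coequaliser r0 r1 e -> is_regular_epi e.
Proof. by move=> h; exists r, r0, r1. Qed.

Lemma kernel_pair_lift (x y r : C) (f : x ~> y) (r0 r1 : r ~> x) (w : C)
    (a b : w ~> x) :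
  is_kernel_pair f r0 r1 -> f ∘ a = f ∘ b ->
  exists h : w ~> r, r0 ∘ h = a /\ r1 ∘ h = b.
Proof. by move=> [_ U] e; have [h [hP _]] := U w a b e; exists h. Qed.

(** The pair of which [e] is the coequaliser factors through the kernel pair, so whatever
    coequalises [r0] and [r1] also coequalises that pair. *)
Lemma regular_epi_coequaliser (x q r : C) (e : x ~> q) (r0 r1 : r ~> x) :
  is_regular_epi e -> is_kernel_pair e r0 r1 -> is_coequaliser r0 r1 e.
Proof.
move=> [s [s0 [s1 [es U]]]] kp; split=> [|z g eg]; first by case: kp.
have [h [h0 h1]] := kernel_pair_lift kp es.
by apply: U; rewrite -h0 -h1 !comp_assoc eg.
Qed.

(** [f] factors as [m ∘ e], so a pair identified by [e] is identified by [f] and lifts. *)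
Lemma kernel_pair_coequaliser (x y q r : C) (f : x ~> y) (r0 r1 : r ~> x) (e : x ~> q) :
  is_kernel_pair f r0 r1 -> is_coequaliser r0 r1 e -> is_kernel_pair e r0 r1.
Proof.
move=> [fr U] [er /(_ _ _ fr) [m [me _]]]; split=> // w a b eab.
by apply: U; rewrite -me -!comp_assoc eab.
Qed.

Lemma kernel_pair_iso_comp (x y z r : C) (i : y ~> z) (f : x ~> y) (r0 r1 : r ~> x) :
  is_iso i -> is_kernel_pair f r0 r1 -> is_kernel_pair (i ∘ f) r0 r1.
Proof.
move=> [j [ji _]] [fr U]; split=> [|w a b e]; first by rewrite -!comp_assoc fr.
apply: U; move/(congr1 (comp j)): e.
by rewrite !comp_assoc ji !comp_idl.
Qed.

Lemma kernel_pair_rel_le (a y : C) (f : a ~> y) (r s : RelRep a) :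
  is_kernel_pair_of f r -> f ∘ rel_fst s = f ∘ rel_snd s -> rel_le s r.
Proof. by move=> kp e; have [h hP] := kernel_pair_lift kp e; exists h. Qed.

Lemma rel_le_coequalises (a y : C) (f : a ~> y) (r s : RelRep a) :
  f ∘ rel_fst r = f ∘ rel_snd r -> rel_le s r -> f ∘ rel_fst s = f ∘ rel_snd s.
Proof. by move=> e [h [<- <-]]; rewrite !comp_assoc e. Qed.

(** The universal property of a coequaliser turns the order on quotients into an equation, which can
    be tested against kernel pairs and kernels. *)
Lemma quot_le_kernel_pair (a : C) (q q' : QuotRep a) (r : RelRep a) :
  is_regular_epi (qt_map q) -> is_kernel_pair_of (qt_map q) r ->
  (quot_le q q' <-> qt_map q' ∘ rel_fst r = qt_map q' ∘ rel_snd r).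
Proof.
move=> eq kp; have [er U] := regular_epi_coequaliser eq kp; split.
- by move=> [h <-]; rewrite -!comp_assoc er.
- by move=> /U[h [hP _]]; exists h.
Qed.

Hypothesis pb : Pullbacks C.
Hypothesis coeq : forall (x y r : C) (f : x ~> y) (r0 r1 : r ~> x),
  is_kernel_pair f r0 r1 -> exists (q : C) (e : x ~> q), is_coequaliser r0 r1 e.

Lemma kernel_pair_exists (a y : C) (f : a ~> y) : exists r, is_kernel_pair_of f r.
Proof.
exists (Build_RelRep (pb_fst (pb f f)) (pb_snd (pb f f))).
exact: pb_spec.
Qed.

Lemma effective_equivalence_quotient (a : C) (r : RelRep a) :
  is_effective_equivalence r ->
  exists q : QuotRep a, is_regular_epi (qt_map q) /\ is_kernel_pair_of (qt_map q) r.
Proof.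
move=> [y [f kp]]; have [q [e eP]] := coeq kp.
exists (Build_QuotRep e); split; first exact: coequaliser_regular_epi eP.
exact: kernel_pair_coequaliser kp eP.
Qed.

(** Both orders amount to [q'] coequalising the kernel pair of [q]; surjectivity comes from the
    coequaliser of a kernel pair. *)
Lemma Quot_EERel_iso (a : C) :
  exists f : Quot a -> EERel a, is_poset_iso f /\ sends_quotient_to_kernel_pair f.
Proof.
apply: (class_poset_iso (S := quot_reps a) (S' := eerel_reps a)
  (Phi := fun q r => is_kernel_pair_of (qt_map q) r)) => /=.
- by move=> q _; exact: kernel_pair_exists.
- by move=> q r _ kp; exists (qt_cod q), (qt_map q).
- move=> q q' r r' eq eq' kp kp'; rewrite (quot_le_kernel_pair q' eq kp); split.
    exact: kernel_pair_rel_le.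
  by apply: rel_le_coequalises; case: kp'.
- move=> r /effective_equivalence_quotient[q [eq kp]]; exists q, r; split=> //.
  exact: (equiv_refl _ _ (rp_isoP (eerel_reps a))).
Qed.

(** * Zero morphisms and kernels in a pointed category *)

Lemma zero_morphism_comp_l (x y w : C) (f : y ~> w) (g : x ~> y) :
  is_zero_morphism g -> is_zero_morphism (f ∘ g).
Proof. by move=> [z [u [v [zz ->]]]]; exists z, (f ∘ u), v; rewrite comp_assoc. Qed.

Lemma zero_morphism_comp_r (x y w : C) (f : y ~> w) (g : x ~> y) :
  is_zero_morphism f -> is_zero_morphism (f ∘ g).
Proof. by move=> [z [u [v [zz ->]]]]; exists z, u, (v ∘ g); rewrite comp_assoc. Qed.

Lemma zero_morphism_eq (x y : C) (f g : x ~> y) :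
  is_zero_morphism f -> is_zero_morphism g -> f = g.
Proof.
move=> [z [u [v [[iz _] ->]]]] [z' [u' [v' [[_ tz'] ->]]]].
have [i _] := iz z'.
by rewrite (initial_eq iz u (u' ∘ i)) -comp_assoc (terminal_eq tz' (i ∘ v) v').
Qed.

Variable z : C.
Hypothesis zz : is_zero_object z.

Lemma zero_morphism_exists (x y : C) : exists f : x ~> y, is_zero_morphism f.
Proof.
have [iz tz] := zz; have [[u _] [v _]] := (iz y, tz x).
by exists (u ∘ v), z, u, v.
Qed.

Lemma kernel_exists (a b : C) (f : a ~> b) : exists k, is_kernel_of f k.
Proof.
(* The kernel is the pullback of [f] along the zero map [u : z ~> b]. *)
have [iz tz] := zz; have [u _] := iz b.
have [sq U] := pb_spec (pb f u).
exists (Build_SliceOb (pb_fst (pb f u))); split=> /=.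
  by exists z, u, (pb_snd (pb f u)).
move=> w g g0; have [v _] := tz w.
have e : f ∘ g = u ∘ v by apply: zero_morphism_eq => //; exists z, u, v.
have [h [[h1 h2] uh]] := U w g v e.
by exists h; split=> // h' eh'; apply: uh; split=> //; exact: terminal_eq tz _ _ _.
Qed.

(** Since [f] sends both [k] and the zero map to zero, this pair factors through the kernel pair of
    [f], which [e] coequalises; hence [e ∘ k] is zero. This replaces an arbitrary [f] by a regular
    quotient with the same kernel. *)
Lemma is_kernel_of_factor (a b c : C) (f : a ~> b) (e : a ~> c) (m : c ~> b)
    (r : RelRep a) (k : SliceOb a) :
  is_kernel_pair_of f r -> e ∘ rel_fst r = e ∘ rel_snd r -> m ∘ e = f ->
  is_kernel_of f k -> is_kernel_of e k.
Proof.
move=> kp er me [k0 U]; split=> [|w g eg]; last first.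
  by apply: U; rewrite -me -comp_assoc; exact: zero_morphism_comp_l.
have [o o0] := zero_morphism_exists (sl_dom k) a.
have fko : f ∘ sl_arr k = f ∘ o.
  by apply: zero_morphism_eq => //; exact: zero_morphism_comp_l.
have [h [<- ho]] := kernel_pair_lift kp fko.
by rewrite comp_assoc er -comp_assoc ho; exact: zero_morphism_comp_l.
Qed.

(** * Points and protomodularity *)

Lemma pt_iso (x : C) (a b : PtOb x) (h : @hom (Pt x) a b) :
  is_iso (pt_map h) <-> @is_iso (Pt x) a b h.
Proof.
split=> [[g [gh hg]]|[g [gh hg]]]; last first.
  by exists (pt_map g); split; [move/(congr1 (@pt_map _ _ _ _)): gh
                              | move/(congr1 (@pt_map _ _ _ _)): hg].
have ga : pt_arr a ∘ g = pt_arr b.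
  by rewrite -(pt_map_arr h) -comp_assoc hg comp_idr.
have gs : g ∘ pt_sec b = pt_sec a.
  by rewrite -(pt_map_sec h) comp_assoc gh comp_idl.
by exists (Build_PtHom ga gs); split; apply: pt_hom_eq.
Qed.

Lemma product_exists (x y : C) : exists (p : C) (p1 : p ~> x) (p2 : p ~> y),
  forall (w : C) (f : w ~> x) (g : w ~> y),
    exists! h : w ~> p, p1 ∘ h = f /\ p2 ∘ h = g.
Proof.
have [_ tz] := zz; have [[u _] [v _]] := (tz x, tz y).
have [_ U] := pb_spec (pb u v).
exists (pb_ob (pb u v)), (pb_fst (pb u v)), (pb_snd (pb u v)) => w f g.
by apply: U; exact: terminal_eq tz _ _ _.
Qed.

Hypothesis pm : forall (y x : C) (f : y ~> x), reflects_isos (pt_pullback pb f).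

(** Pulling a point back along [0 ~> x] yields the kernel of its arrow. The hypotheses make [h]
    invertible on these kernels, and protomodularity reflects this. *)
Lemma split_short_five (x : C) (a b : PtOb x) (h : @hom (Pt x) a b) :
  is_mono (pt_map h) ->
  (forall (w : C) (g : w ~> pt_dom b), is_zero_morphism (pt_arr b ∘ g) ->
     exists g', pt_map h ∘ g' = g) ->
  is_iso (pt_map h).
Proof.
move=> mh lift; have [iz tz] := zz; have [u _] := iz x.
apply/pt_iso; apply: (pm (f := u)); apply/pt_iso => /=.
set Pa := pb u (pt_arr a); set Pb := pb u (pt_arr b).
have [sqb _] := pb_spec Pb.
have [g eg] : exists g, pt_map h ∘ g = pb_snd Pb.
  by apply: lift; rewrite -sqb; exists z, u, (pb_fst Pb).
have eg' : u ∘ pb_fst Pb = pt_arr a ∘ g.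
  by rewrite -(pt_map_arr h) -comp_assoc eg.
exists (pb_pair Pa eg'); split; apply: pb_eq;
  rewrite comp_assoc ?pb_pair_fst ?pb_pair_snd ?comp_idr //;
  try exact: terminal_eq tz _ _ _.
- by apply: mh; rewrite comp_assoc eg pb_pair_snd.
- by rewrite -comp_assoc pb_pair_snd.
Qed.

(* Protomodularity is applied to the inclusion of the intersection of the two
   kernel pairs, realised as the kernel pair of [<q, q'>], into that of [q]. *)
Lemma kernel_sub_kernel_pair (a b b' : C) (q : a ~> b) (q' : a ~> b')
    (r : RelRep a) (k k' : SliceOb a) :
  is_kernel_pair_of q r -> is_kernel_of q k -> is_kernel_of q' k' -> sub_le k k' ->
  q' ∘ rel_fst r = q' ∘ rel_snd r.
Proof.
move=> kp [_ Uk] [k'0 _] [i ki].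
have [p [p1 [p2 Up]]] := product_exists b b'.
have [qq [[qq1 qq2] _]] := Up a q q'.
have [s kps] := kernel_pair_exists qq.
have pq (w : C) (f g : w ~> a) : q ∘ f = q ∘ g -> q' ∘ f = q' ∘ g -> qq ∘ f = qq ∘ g.
  move=> e e'; have [h [_ uh]] := Up w (q ∘ f) (q' ∘ f).
  by rewrite -(uh (qq ∘ f)) ?(uh (qq ∘ g)) // !comp_assoc qq1 qq2.
have [es _] := kps; have [er _] := kp.
have qs : q ∘ rel_fst s = q ∘ rel_snd s by rewrite -qq1 -!comp_assoc es.
have q's : q' ∘ rel_fst s = q' ∘ rel_snd s by rewrite -qq2 -!comp_assoc es.
have [m [m0 m1]] := kernel_pair_lift kp qs.
(* The diagonals are sections of the first projections, so both kernel pairs become points over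
   [a]. *)
have [dr [dr0 dr1]] := kernel_pair_lift (a := idm a) (b := idm a) kp erefl.
have [ds [ds0 ds1]] := kernel_pair_lift (a := idm a) (b := idm a) kps erefl.
have effr : is_effective_equivalence r by exists b, q.
have effs : is_effective_equivalence s by exists p, qq.
have md : m ∘ ds = dr.
  by apply: (effective_jointly_monic effr); rewrite comp_assoc ?m0 ?m1 ?ds0 ?ds1.
pose ps := Build_PtOb ds0; pose pr := Build_PtOb dr0.
pose h : @hom (Pt a) ps pr := @Build_PtHom _ _ ps pr m m0 md.
(* An inverse [n] of the inclusion [m] transports the equation [q's] from [s] to [r]. *)
suff [n [_ mn]] : is_iso (pt_map h).
  have : q' ∘ (rel_fst r ∘ (m ∘ n)) = q' ∘ (rel_snd r ∘ (m ∘ n)).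
    rewrite [rel_fst r ∘ _]comp_assoc [rel_snd r ∘ _]comp_assoc m0 m1.
    by rewrite !comp_assoc q's.
  by move: mn => /= ->; rewrite !comp_idr.
apply: split_short_five => [w f g /= e|w g /= g0].
  apply: (effective_jointly_monic effs).
    by rewrite -m0 -!comp_assoc e.
  by rewrite -m1 -!comp_assoc e.
(* As [g] is killed by the first projection, its second projection is killed by [q], so it factors
   through [k], hence through [k'], and is killed by [q']. Thus [g] lies in the intersection. *)
have [l [lk _]] : exists! l, sl_arr k ∘ l = rel_snd r ∘ g.
  by apply: Uk; rewrite comp_assoc -er -comp_assoc; exact: zero_morphism_comp_l.
have q'g : q' ∘ (rel_fst r ∘ g) = q' ∘ (rel_snd r ∘ g).
  apply: zero_morphism_eq; first exact: zero_morphism_comp_l.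
  rewrite -lk -ki -comp_assoc comp_assoc.
  exact: zero_morphism_comp_r.
have qg : q ∘ (rel_fst r ∘ g) = q ∘ (rel_snd r ∘ g) by rewrite !comp_assoc er.
have [g' [g'0 g'1]] := kernel_pair_lift kps (pq _ _ _ qg q'g).
exists g'; apply: (effective_jointly_monic effr); rewrite comp_assoc.
  by rewrite m0.
by rewrite m1.
Qed.

(** That a larger kernel gives a further quotient is where protomodularity enters; surjectivity
    replaces a map by the coequaliser of its kernel pair. *)
Lemma Quot_NSub_iso (a : C) :
  exists f : Quot a -> NSub a, is_poset_iso f /\ sends_quotient_to_kernel f.
Proof.
apply: (class_poset_iso (S := quot_reps a) (S' := nsub_reps a)
  (Phi := fun q k => is_kernel_of (qt_map q) k)) => /=.
- by move=> q _; exact: kernel_exists.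
- by move=> q k _ kq; exists (qt_cod q), (qt_map q).
- move=> q q' k k' eq eq' kq kq'; have [r kp] := kernel_pair_exists (qt_map q).
  split; last first.
    by move=> kk'; apply/(quot_le_kernel_pair q' eq kp); exact: (kernel_sub_kernel_pair kp kq kq' kk').
  move=> [h hq]; have [k0 _] := kq; have [_ U] := kq'.
  have [l [lk _]] : exists! l, sl_arr k' ∘ l = sl_arr k.
    by apply: U; rewrite -hq -comp_assoc; exact: zero_morphism_comp_l.
  by exists l.
- move=> k [b [f kf]]; have [r kp] := kernel_pair_exists f.
  have [q [e eP]] := coeq kp.
  exists (Build_QuotRep e), k; split; first exact: coequaliser_regular_epi eP.
    have [er U] := eP; have [fr _] := kp; have [m [me _]] := U _ f fr.
    exact: is_kernel_of_factor kp er me kf.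
  exact: (equiv_refl _ _ (rp_isoP (nsub_reps a))).
Qed.

End Categories.

(** * Equivalences and right adjoints *)

Section Equivalences.

Variables (C D : Category) (F : Functor C D).
Hypothesis eqF : is_equivalence F.

Lemma equivalence_faithful (x y : C) (f g : x ~> y) : fmap F f = fmap F g -> f = g.
Proof.
have [G [[eta ieta] _]] := eqF => e.
have [k [ke _]] := ieta y.
rewrite -(comp_idl f) -(comp_idl g) -ke -!comp_assoc.
by congr (_ ∘ _); rewrite (naturality eta f) (naturality eta g) /= e.
Qed.

(** The candidate built from [eta] satisfies only [G (F f) = G g] at first, as no triangle identity
    links [eta] and [eps]; naturality of the invertible [eps] then cancels [G]. *)
Lemma equivalence_full (x y : C) (g : F x ~> F y) : exists f : x ~> y, fmap F f = g.
Proof.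
have [G [[eta ieta] [eps ieps]]] := eqF.
have [k [_ ek]] := ieta y; have [l [_ el]] := ieta x.
have [j [_ ej]] := ieps (F x).
pose f := k ∘ (fmap G g ∘ eta x); exists f.
have GF : fmap G (fmap F f) = fmap G g.
  have : eta y ∘ f = fmap G (fmap F f) ∘ eta x by exact: (naturality eta f).
  rewrite /f comp_assoc ek comp_idl => /(congr1 (fun h => h ∘ l)) /=.
  by rewrite -!comp_assoc el !comp_idr.
rewrite -(comp_idr (fmap F f)) -(comp_idr g) -ej !comp_assoc.
congr (_ ∘ _).
have n1 : eps (F y) ∘ fmap F (fmap G (fmap F f)) = fmap F f ∘ eps (F x).
  exact: (naturality eps (fmap F f)).
have n2 : eps (F y) ∘ fmap F (fmap G g) = g ∘ eps (F x) by exact: (naturality eps g).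
by rewrite -n1 -n2 GF.
Qed.

Lemma equivalence_ess_surj (d : D) : exists (c : C) (i : d ~> F c), is_iso i.
Proof.
have [G [_ [eps ieps]]] := eqF; have [i [ie ei]] := ieps d.
by exists (G d), i, (eps d).
Qed.

End Equivalences.

Lemma right_adjoint_kernel_pair (A X : Category) (U : Functor A X) (L : LeftAdjoint U)
    (a b : A) (f : a ~> b) (r : RelRep a) :
  is_kernel_pair_of f r -> is_kernel_pair_of (fmap U f) (rel_image U r).
Proof.
pose F := la_functor L; pose eta := la_unit L; pose eps := la_counit L.
(* [adjK] and [adj_inj] give the hom-set bijection of the adjunction, along which the universal
   property is transposed. *)
have adjK (x : X) (c : A) (u : x ~> U c) : fmap U (eps c ∘ fmap F u) ∘ eta x = u.
  rewrite fmap_comp -comp_assoc -[fmap U (fmap F u) ∘ eta x](naturality eta u).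
  by rewrite comp_assoc la_triangle_r comp_idl.
have adj_inj (x : X) (c : A) (g h : F x ~> c) :
    fmap U g ∘ eta x = fmap U h ∘ eta x -> g = h.
  have red (k : F x ~> c) : eps c ∘ fmap F (fmap U k ∘ eta x) = k.
    rewrite fmap_comp comp_assoc [eps c ∘ _](naturality eps k).
    by rewrite -comp_assoc la_triangle_l comp_idr.
  by move=> e; rewrite -(red g) e red.
move=> [fr Up]; split=> [|w u v e] /=; first by rewrite -!fmap_comp fr.
have e' : f ∘ (eps a ∘ fmap F u) = f ∘ (eps a ∘ fmap F v).
  by apply: adj_inj; rewrite !(fmap_comp U f) -!comp_assoc !adjK.
have [h [[h0 h1] uh]] := Up _ _ _ e'.
exists (fmap U h ∘ eta w); split.
  by split; rewrite comp_assoc -fmap_comp ?h0 ?h1 adjK.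
move=> k [k0 k1]; rewrite -(adjK _ _ k); congr (fmap U _ ∘ _).
apply: uh; split; apply: adj_inj; rewrite adjK fmap_comp -comp_assoc adjK //.
Qed.

(** * Descent of algebra structures to regular quotients *)

Section QuotientAlgebras.

Variables (X : Category) (T : Monad X).
Hypothesis pb : Pullbacks X.
Hypothesis pointed : is_pointed X.
Hypothesis coprod : has_finite_coproducts X.
Hypothesis nullary : essentially_nullary T.
Hypothesis epiT : preserves_regular_epis T.
Hypothesis kpT : preserves_kernel_pairs T.

Lemma binary_coproduct_exists (x y : X) :
  exists (s : X) (i1 : x ~> s) (i2 : y ~> s), is_binary_coproduct i1 i2.
Proof.
have [|s [inj U]] := @coprod bool (fun b => if b then x else y).
  by exists (cons true (cons false nil)); case; [left | right; left].
exists s, (inj true), (inj false) => z f g.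
have [h [hP uh]] := U z (fun b => if b return (if b then x else y) ~> z then f else g).
exists h; split; first by split; [exact: hP true | exact: hP false].
by move=> h' [e1 e2]; apply: uh; case.
Qed.

(** The copairing of [T u] and the unit is a strong epimorphism, hence epic, so these two maps are
    jointly epic. *)
Lemma essentially_nullary_eq (z x y : X) (u : z ~> x) (f g : T x ~> y) :
  is_initial z -> f ∘ fmap T u = g ∘ fmap T u ->
  f ∘ mon_unit T x = g ∘ mon_unit T x -> f = g.
Proof.
move=> iz e0 e1; have [s [i1 [i2 U]]] := binary_coproduct_exists (T z) x.
have [m [[m1 m2] _]] := U _ (fmap T u) (mon_unit T x).
apply: (strong_epi_epi (nullary iz U m1 m2)).
have [h [_ uh]] := U _ (f ∘ fmap T u) (f ∘ mon_unit T x).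
have <- : h = f ∘ m by apply: uh; rewrite -!comp_assoc m1 m2.
by apply: uh; rewrite -!comp_assoc m1 m2 e0 e1.
Qed.

Lemma quotient_algebra (a : Algebra T) (b : X) (q : alg_ob a ~> b) :
  is_regular_epi q ->
  exists beta : T b ~> b,
    [/\ beta ∘ mon_unit T b = idm b,
        beta ∘ fmap T beta = beta ∘ mon_mult T b
      & q ∘ alg_act a = beta ∘ fmap T q].
Proof.
move=> eq; have eTq := epiT eq; have eTTq := epiT eTq.
have [r kp] := kernel_pair_exists pb q.
(* By the two preservation hypotheses, [T q] is the coequaliser of the image under [T] of the kernel
   pair of [q]. *)
have [_ U] := regular_epi_coequaliser eTq (kpT kp).
have [z [iz _]] := pointed; have [u _] := iz (rel_ob r).
have nat_eta (x y : X) (f : x ~> y) : mon_unit T y ∘ f = fmap T f ∘ mon_unit T x.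
  exact: (naturality (mon_unit T) f).
have nat_mu (x y : X) (f : x ~> y) :
    mon_mult T y ∘ fmap T (fmap T f) = fmap T f ∘ mon_mult T x.
  exact: (naturality (mon_mult T) f).
have act_eta (w : X) (f : w ~> alg_ob a) : alg_act a ∘ fmap T f ∘ mon_unit T w = f.
  by rewrite -comp_assoc -nat_eta comp_assoc alg_unit comp_idl.
have cong : q ∘ alg_act a ∘ fmap T (rel_fst r) = q ∘ alg_act a ∘ fmap T (rel_snd r).
  apply: (essentially_nullary_eq (u := u) iz).
    rewrite -!comp_assoc -!fmap_comp.
    by rewrite (initial_eq iz (rel_fst r ∘ u) (rel_snd r ∘ u)).
  rewrite -!(comp_assoc q) !act_eta.
  by case: kp.
have [beta [eb _]] := U _ _ cong.
exists beta; split=> //.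
(* The algebra laws are inherited from [a]: the unit law is tested on the epimorphism [q],
   associativity on [T (T q)]. *)
- apply: (regular_epi_epi eq).
  by rewrite -comp_assoc nat_eta comp_assoc eb -comp_assoc alg_unit comp_idl comp_idr.
- apply: (regular_epi_epi eTTq).
  rewrite -comp_assoc -fmap_comp eb fmap_comp comp_assoc eb -comp_assoc alg_mult.
  by rewrite -[RHS]comp_assoc nat_mu !comp_assoc eb.
Qed.

End QuotientAlgebras.

(** * Effective equivalence relations along a monadic functor *)

Section MonadicFunctors.

Variables (A X : Category) (U : Functor A X) (L : LeftAdjoint U).
Hypothesis pbA : Pullbacks A.
Hypothesis pbX : Pullbacks X.
Hypothesis coeqX : forall (x y r : X) (f : x ~> y) (r0 r1 : r ~> x),
  is_kernel_pair f r0 r1 -> exists (q : X) (e : x ~> q), is_coequaliser r0 r1 e.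
Hypothesis monU : monadic_via L.
Hypothesis pointed : is_pointed X.
Hypothesis coprod : has_finite_coproducts X.
Hypothesis nullary : essentially_nullary (induced_monad L).
Hypothesis epiT : preserves_regular_epis (induced_monad L).
Hypothesis kpT : preserves_kernel_pairs (induced_monad L).

(** [U] is the comparison equivalence followed by the faithful forgetful functor. *)
Lemma monadic_faithful (x y : A) (f g : x ~> y) : fmap U f = fmap U g -> f = g.
Proof. by move=> e; apply: (equivalence_faithful monU); apply: alg_hom_eq. Qed.

(** The quotient algebra is carried back to [A] by essential surjectivity and fullness of the
    comparison functor; the first accounts for the isomorphism [i]. *)
Lemma regular_quotient_lift (a : A) (b : X) (q : U a ~> b) :
  is_regular_epi q ->
  exists (c : A) (f : a ~> c) (i : b ~> U c), is_iso i /\ fmap U f = i ∘ q.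
Proof.
move=> eq.
have [beta [bu bm bq]] :=
  quotient_algebra pbX pointed coprod nullary epiT kpT (a := comparison_ob L a) eq.
pose B : EilenbergMoore (induced_monad L) := @Build_Algebra X (induced_monad L) b beta bu bm.
pose h : @hom (EilenbergMoore (induced_monad L)) (comparison L a) B :=
  @Build_AlgHom X (induced_monad L) (comparison_ob L a) B q bq.
have [c [i [j [ji ij]]]] := equivalence_ess_surj monU B.
have [f ef] := equivalence_full monU (i ∘ h).
exists c, f, (alg_map i); split; last exact: (congr1 (@alg_map _ _ _ _) ef).
exists (alg_map j); split.
- exact: (congr1 (@alg_map _ _ _ _) ji).
- exact: (congr1 (@alg_map _ _ _ _) ij).
Qed.

Lemma EERel_image_iso (a : A) :
  exists f : EERel a -> EERel (U a), is_poset_iso f /\ sends_relation_to_image f.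
Proof.
have [||||f [isof fP]] := class_poset_iso (S := eerel_reps a) (S' := eerel_reps (U a))
  (Phi := fun r s => s = rel_image U r); last first.
- by exists f; split=> // c r cr; exact: fP cr erefl.
(* A preimage of [s] is the kernel pair of the lift [f] of its quotient [q]: its image and [s] are
   both kernel pairs of [U f], which is [i ∘ q]. *)
- move=> s /(effective_equivalence_quotient coeqX)[q [eq kp]].
  have [c [f [i [ii fE]]]] := regular_quotient_lift eq.
  have [r kpf] := kernel_pair_exists pbA f.
  exists r, (rel_image U r).
  have kp1 := right_adjoint_kernel_pair L kpf.
  have kp2 := kernel_pair_iso_comp ii kp; rewrite -fE in kp2.
  split=> //; first by exists c, f.
  apply: (@rp_le_iso (eerel_reps (U a))).
  + by exists (U c), (fmap U f).
  + by exists (U c), (fmap U f).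
  + by apply: kernel_pair_rel_le kp2 _; case: kp1.
  + by apply: kernel_pair_rel_le kp1 _; case: kp2.
- move=> r r' s s' _ [c [f kp]] -> ->; split=> /=.
    by move=> [h [h0 h1]]; exists (fmap U h); rewrite /= -!fmap_comp h0 h1.
  (* Reflecting the order reduces to an equation between parallel maps in [A], which the faithful
     [U] reflects. *)
  move=> le; apply: (kernel_pair_rel_le kp); apply: monadic_faithful.
  rewrite !fmap_comp; apply: (rel_le_coequalises _ le) => /=.
  by rewrite -!fmap_comp; case: kp => ->.
- move=> r s [c [f kp]] ->; exists (U c), (fmap U f).
  exact: right_adjoint_kernel_pair.
- by move=> r _; exists (rel_image U r).
Qed.

End MonadicFunctors.

Theorem theorem3p2 (A X : Category) (U : Functor A X) (L : LeftAdjoint U)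
    (hA : is_ideally_regular A)
    (hU : monadic_via L)
    (hX : is_homological X)
    (hXcoprod : has_finite_coproducts X)
    (hTnullary : essentially_nullary (induced_monad L))
    (hTepi : preserves_regular_epis (induced_monad L))
    (hTkp : preserves_kernel_pairs (induced_monad L))
    (a : A) :
  (exists f : Quot a -> EERel a,
     is_poset_iso f /\ sends_quotient_to_kernel_pair f) /\
  (exists f : EERel a -> EERel (U a),
     is_poset_iso f /\ sends_relation_to_image f) /\
  (exists f : Quot (U a) -> EERel (U a),
     is_poset_iso f /\ sends_quotient_to_kernel_pair f) /\
  (exists f : Quot (U a) -> NSub (U a),
     is_poset_iso f /\ sends_quotient_to_kernel f).
Proof.
(* The pullbacks are those witnessing protomodularity, so [pmX] concerns the same [pbX] from which
   kernels and kernel pairs are built. *)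
have [[_ coeqA _] [_ [pbA _]] _ _] := hA.
have [pX [_ coeqX _] [_ [pbX pmX]]] := hX; have [z zz] := pX.
split; first exact: Quot_EERel_iso.
split; first exact: (EERel_image_iso pbA pbX coeqX hU).
split; first exact: Quot_EERel_iso.
exact: (Quot_NSub_iso coeqX zz pmX).
Qed.
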